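(* The face lattice of $ASM_n$ is isomorphic to the lattice of all elementary flow grids of order $n$ (including the empty grid, corresponding to the empty face) ordered by inclusion of edge sets. Explicitly, the map sending a face $F$ to $g(F)=\bigcup_{A\text{ a vertex of }F} g(A)$ is an inclusion-preserving bijection from faces of $ASM_n$ to elementary flow grids, with inverse $G\mapsto \operatorname{conv}\{A : A \text{ an } n\times n \text{ ASM with } g(A)\subseteq G\}$.
   Context: An alternating sign matrix (ASM) is a square matrix with entries in $\{0,1,-1\}$ such that the entries of each row and each column sum to $1$, and the nonzero entries in each row and each column alternate in sign. $ASM_n$ is the convex hull in $\mathbb{R}^{n^2}$ of the $n\times n$ ASMs; its vertices are the ASMs. The complete flow grid $C_n$ is the directed graph with internal vertices $(i,j)$, $1\le i,j\le n$, and boundary vertices $(i,0),(0,j),(i,n+1),(n+1,j)$, $1\le i,j\le n$, with edge set $\{((i,j),(i,j\pm1)),((i,j),(i\pm1,j)) : 1\le i,j\le n\}$. A simple flow grid of order $n$ is a subgraph of $C_n$ containing all vertices of $C_n$ in which each internal vertex has exactly four incident edges, either all directed inward, all directed outward, or with the two horizontal edges pointing in the same direction and the two vertical edges pointing in the same direction. For an ASM $A=(a_{ij})$, $g(A)$ is the simple flow grid containing an edge $(v,w)$ of $C_n$, $v=(i,j)$, iff the partial sum of the row (for horizontal $(v,w)$) or column (for vertical $(v,w)$) of $A$ from the border on the side opposite $w$ up to and including $a_{ij}$ equals $1$; $A\mapsto g(A)$ is a bijection between ASMs and simple flow grids. An elementary flow grid is a subgraph of $C_n$ whose edge set is a union of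 edge sets of simple flow grids. *)

(* Defs.v *)
From mathcomp Require Import all_boot all_order all_algebra.
From mathcomp Require Import boolp classical_sets functions reals.

Set Implicit Arguments.
Unset Strict Implicit.
Unset Printing Implicit Defensive.

Import GRing.Theory Num.Theory.
Local Open Scope classical_set_scope.
Local Open Scope ring_scope.

(** Convex hulls and faces in the space ['M[R]_n] of real [n x n] matrices. *)

Definition conv (R : realType) (n : nat) (S : set 'M[R]_n) : set 'M[R]_n :=
  [set x | exists (m : nat) (v : 'I_m -> 'M[R]_n) (a : 'I_m -> R),
    [/\ forall k, S (v k),
        forall k, 0 <= a k,
        \sum_(k < m) a k = 1
      & x = \sum_(k < m) a k *: v k]].

Definition dotmx (R : realType) (n : nat) (c x : 'M[R]_n) : R :=
  \sum_(i < n) \sum_(j < n) c i j * x i j.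

(* The functional [c] may be zero, so [P] itself ([c = 0], [b = 0]) and the
   empty set ([c = 0], [b = 1]) are faces of [P]. *)
Definition faces (R : realType) (n : nat) (P : set 'M[R]_n) :
    set (set 'M[R]_n) :=
  [set F | exists (c : 'M[R]_n) (b : R),
    (forall x, P x -> dotmx c x <= b) /\
    F = P `&` [set x | dotmx c x = b]].

Definition vertices (R : realType) (n : nat) (P : set 'M[R]_n) :
    set 'M[R]_n :=
  [set v | faces P [set v]].

Definition is_ASM (R : realType) (n : nat) (A : 'M[R]_n) : Prop :=
  [/\ forall i j, [\/ A i j = 0, A i j = 1 | A i j = -1],
      forall i, \sum_(j < n) A i j = 1,
      forall j, \sum_(i < n) A i j = 1,
      forall i (j k : 'I_n), (j < k)%N -> A i j != 0 -> A i k != 0 ->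
        (forall l : 'I_n, (j < l < k)%N -> A i l = 0) -> A i k = - A i j
    & forall j (i k : 'I_n), (i < k)%N -> A i j != 0 -> A k j != 0 ->
        (forall l : 'I_n, (i < l < k)%N -> A l j = 0) -> A k j = - A i j].

Definition ASM_polytope (R : realType) (n : nat) : set 'M[R]_n :=
  conv (@is_ASM R n).
Arguments ASM_polytope : clear implicits.

(** Flow grids.  A vertex [(i, j)] is in row [i] (numbered downwards) and
    column [j].  All the subgraphs of the complete flow grid considered here
    contain all of its vertices, so a grid is identified with its edge set;
    an edge [(v, w)] is directed from [v] to [w]. *)

Definition vertex : Type := (nat * nat)%type.
Definition edge : Type := (vertex * vertex)%type.
Definition grid : Type := set edge.

Definition internal (n : nat) : set vertex :=
  [set v | (1 <= v.1 <= n)%N && (1 <= v.2 <= n)%N].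

Definition lft (v : vertex) : vertex := (v.1, v.2.-1).
Definition rgt (v : vertex) : vertex := (v.1, v.2.+1).
Definition abv (v : vertex) : vertex := (v.1.-1, v.2).
Definition blw (v : vertex) : vertex := (v.1.+1, v.2).

Definition complete_flow_grid (n : nat) : grid :=
  [set e | internal n e.1 /\
    [\/ e.2 = lft e.1, e.2 = rgt e.1, e.2 = abv e.1 | e.2 = blw e.1]].

Definition incident (G : grid) (v : vertex) : set edge :=
  [set e | G e /\ (e.1 = v \/ e.2 = v)].

Definition all_in (v : vertex) : set edge :=
  [set (lft v, v); (rgt v, v); (abv v, v); (blw v, v)].
Definition all_out (v : vertex) : set edge :=
  [set (v, lft v); (v, rgt v); (v, abv v); (v, blw v)].

Definition rightward (v : vertex) : set edge := [set (lft v, v); (v, rgt v)].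
Definition leftward (v : vertex) : set edge := [set (rgt v, v); (v, lft v)].
Definition downward (v : vertex) : set edge := [set (abv v, v); (v, blw v)].
Definition upward (v : vertex) : set edge := [set (blw v, v); (v, abv v)].

Definition simple_flow_grid (n : nat) : set grid :=
  [set G | G `<=` complete_flow_grid n /\
    forall v, internal n v ->
      [\/ incident G v = all_in v,
          incident G v = all_out v
        | exists H V : set edge,
            [/\ H = rightward v \/ H = leftward v,
                V = downward v \/ V = upward v
              & incident G v = H `|` V]]].

Definition elementary_flow_grid (n : nat) : set grid :=
  [set G | exists S : set grid,
    S `<=` simple_flow_grid n /\ G = \bigcup_(H in S) H].

(* The matrix entry with 0-based indices [i, j : 'I_n] sits at the internal
   vertex [(i.+1, j.+1)].  The four cases are the edges to the right, to the
   left, downwards and upwards; the partial sums run from the left, right, top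
   and bottom border respectively. *)
Definition gmx (R : realType) (n : nat) (A : 'M[R]_n) : grid :=
  [set e | exists i j : 'I_n, e.1 = (i.+1, j.+1) /\
    [\/ e.2 = rgt e.1 /\ \sum_(k < n | (k <= j)%N) A i k = 1,
        e.2 = lft e.1 /\ \sum_(k < n | (j <= k)%N) A i k = 1,
        e.2 = blw e.1 /\ \sum_(k < n | (k <= i)%N) A k j = 1
      | e.2 = abv e.1 /\ \sum_(k < n | (i <= k)%N) A k j = 1]].

Definition gface (R : realType) (n : nat) (F : set 'M[R]_n) : grid :=
  \bigcup_(A in vertices F) gmx A.

Definition face_of_grid (R : realType) (n : nat) (G : grid) : set 'M[R]_n :=
  conv [set A : 'M[R]_n | is_ASM A /\ gmx A `<=` G].
Arguments face_of_grid : clear implicits.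

Definition is_inclusion_lattice (T : Type) (X : set (set T)) : Prop :=
  forall A B, X A -> X B ->
    (exists M, [/\ X M, M `<=` A, M `<=` B
      & forall C, X C -> C `<=` A -> C `<=` B -> C `<=` M]) /\
    (exists J, [/\ X J, A `<=` J, B `<=` J
      & forall C, X C -> A `<=` C -> B `<=` C -> J `<=` C]).

(* Main.v *)
(** By the definition of [g], the edges of the complete flow grid that are not
    in [gmx A] are those along which a partial row or column sum of [A] is [0],
    the other partial sums being [1].  The sum of the partial sums over the
    edges outside a grid [G] is thus a linear form which is nonnegative on
    alternating sign matrices and vanishes exactly when [gmx A `<=` G], so
    [face_of_grid G] is a face.

    Conversely, let [F] be a face, and [B] an alternating sign matrix each edge
    of which is an edge of one of the matrices [A_1, ..., A_N] of [F].  Then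
    [\sum_k A_k - B] has nonnegative integer partial sums and line sums [N - 1]:
    it is a higher spin alternating sign matrix in the sense of Behrend and
    Knight.  Slicing its corner sums [h] into [(h + m) %/ (N - 1)], which add up
    to [h] by Hermite's identity, writes it as a sum of [N - 1] alternating sign
    matrices.  A linear form that attains its maximum at each [A_k] therefore
    attains it at [B], so [B] lies in [F]. *)

From HB Require Import structures.
From mathcomp Require Import all_boot all_order all_algebra.
From mathcomp Require Import boolp classical_sets functions reals.
From mathcomp Require Import zify lra.
Require Import Defs.

Set Implicit Arguments.
Unset Strict Implicit.
Unset Printing Implicit Defensive.

Import Order.TTheory GRing.Theory Num.Theory.

Local Open Scope classical_set_scope.
Local Open Scope ring_scope.

Lemma weighted_sum_tight (R : realDomainType) (I : finType) (a y : I -> R)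
    (b : R) :
  (forall i, 0 <= a i) -> (forall i, y i <= b) ->
  \sum_i a i * y i = (\sum_i a i) * b -> forall i, a i != 0 -> y i = b.
Proof.
move=> a_ge0 yb sumE i ai.
have gap0 : \sum_i a i * (b - y i) = 0.
  by under eq_bigr do rewrite mulrBr; rewrite sumrB sumE mulr_suml subrr.
have gap_ge0 j : true -> 0 <= a j * (b - y j) by rewrite mulr_ge0 ?subr_ge0.
have /(_ i isT)/eqP := psumr_eq0P gap_ge0 gap0.
by rewrite mulf_eq0 (negbTE ai) subr_eq0 eq_sym => /eqP.
Qed.

Section LinearForms.
Variables (R : realType) (n : nat).
Implicit Types (c x : 'M[R]_n).

Lemma dotmx_is_scalar c : scalar (dotmx c).
Proof.
move=> a x y; rewrite /dotmx mulr_sumr -big_split; apply: eq_bigr => i _.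
rewrite mulr_sumr -big_split; apply: eq_bigr => j _.
by rewrite !mxE mulrDr mulrCA.
Qed.

HB.instance Definition _ c :=
  GRing.isLinear.Build R 'M[R]_n R *%R (dotmx c) (dotmx_is_scalar c).

Lemma dot0mx x : dotmx 0 x = 0.
Proof. by apply: big1 => i _; apply: big1 => j _; rewrite mxE mul0r. Qed.

Lemma scalar_dotmx (f : {scalar 'M[R]_n}) : exists c, f =1 dotmx c.
Proof.
exists (\matrix_(i, j) f (delta_mx i j)) => x.
rewrite [in LHS](matrix_sum_delta x) linear_sum; apply: eq_bigr => i _.
by rewrite linear_sum; apply: eq_bigr => j _; rewrite linearZ /= mxE mulrC.
Qed.

End LinearForms.

Section ConvexHulls.
Variables (R : realType) (n : nat).
Implicit Types (S P F : set 'M[R]_n) (c x : 'M[R]_n).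

Lemma subset_conv S : S `<=` conv S.
Proof.
move=> x Sx; exists 1%N, (fun=> x), (fun=> 1).
by split=> //; rewrite big_ord1 ?scale1r.
Qed.

Lemma conv_mono S S' : S `<=` S' -> conv S `<=` conv S'.
Proof.
move=> SS' x [m [v [a [Sv a_ge0 a_sum1 ->]]]].
by exists m, v, a; split=> // k; apply: SS'.
Qed.

Lemma conv_neq0 S x : conv S x -> S !=set0.
Proof.
move=> [[|m] [v [a [Sv _ a_sum1 _]]]]; last by exists (v ord0).
by move/esym/eqP: a_sum1; rewrite big_ord0 oner_eq0.
Qed.

Lemma conv_set1 x : conv [set x] = [set x].
Proof.
apply/seteqP; split; last exact: subset_conv.
move=> _ [m [v [a [vx _ a_sum1 ->]]]].
by under eq_bigr do rewrite vx; rewrite -scaler_suml a_sum1 scale1r.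
Qed.

Lemma conv_dotmx_le S c b x :
  (forall y, S y -> dotmx c y <= b) -> conv S x -> dotmx c x <= b.
Proof.
move=> cb [m [v [a [Sv a_ge0 a_sum1 ->]]]].
rewrite linear_sum -[b]mul1r -a_sum1 mulr_suml.
by apply: ler_sum => k _; rewrite linearZ ler_wpM2l // cb.
Qed.

Lemma conv_dotmx_eq S c b x :
  (forall y, S y -> dotmx c y = b) -> conv S x -> dotmx c x = b.
Proof.
move=> cb [m [v [a [Sv _ a_sum1 ->]]]].
rewrite linear_sum -[b]mul1r -a_sum1 mulr_suml.
by apply: eq_bigr => k _; rewrite linearZ /= cb.
Qed.

Lemma conv_face S c b : (forall x, S x -> dotmx c x <= b) ->
  conv S `&` [set x | dotmx c x = b] = conv (S `&` [set x | dotmx c x = b]).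
Proof.
move=> cb; apply/seteqP; split=> [x [] | x Sbx].
  move=> [m [v [a [Sv a_ge0 a_sum1 ->]]]] /= xb.
  have tight k : a k != 0 -> dotmx c (v k) = b.
    apply: (weighted_sum_tight (y := dotmx c \o v) a_ge0) => [l|].
      exact: cb.
    rewrite a_sum1 mul1r -[RHS]xb linear_sum.
    by apply: eq_bigr => l _; rewrite linearZ.
  have [k0 ak0] : exists k, a k != 0.
    apply: contrapT => /forallNP a_eq0; move/esym/eqP: a_sum1.
    rewrite big1 ?oner_eq0 // => k _.
    exact/eqP/negPn/negP/a_eq0.
  exists m, (fun k => if a k == 0 then v k0 else v k), a; split=> //.
    by move=> k; case: ifPn => ak; split=> //=; apply: tight.
  by apply: eq_bigr => k _; case: ifPn => // /eqP ->; rewrite !scale0r.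
split; first by apply: conv_mono Sbx => y [].
by apply: conv_dotmx_eq Sbx => y [].
Qed.

Lemma face_convE S F : faces (conv S) F <->
  exists c b, (forall x, S x -> dotmx c x <= b) /\
    F = conv (S `&` [set x | dotmx c x = b]).
Proof.
split=> [[c [b [cb ->]]]|[c [b [cb ->]]]]; exists c, b.
  have cbS x : S x -> dotmx c x <= b by move/subset_conv; exact: cb.
  by rewrite conv_face.
by split=> [x|]; [exact: conv_dotmx_le | rewrite conv_face].
Qed.

Lemma faces_set0 P : faces P set0.
Proof.
exists 0, 1; split=> [x _|]; first by rewrite dot0mx ler01.
apply/esym; rewrite -subset0 => x [_ /= /esym/eqP].
by rewrite dot0mx oner_eq0.
Qed.

Lemma face_summand P F (I J : finType) (x : I -> 'M[R]_n) (y : 'M[R]_n)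
    (z : J -> 'M[R]_n) :
  faces P F -> (forall i, F (x i)) -> P y -> (forall j, P (z j)) ->
  #|I| = #|J|.+1 -> \sum_i x i = y + \sum_j z j -> F y.
Proof.
move=> [c [b [cb ->]]] Fx Py Pz cardI sumE; split=> //.
apply/eqP; rewrite eq_le cb //=.
have : \sum_j dotmx c (z j) <= b *+ #|J|.
  by rewrite -sumr_const; apply: ler_sum => j _; exact: cb.
have : b *+ #|J|.+1 = dotmx c y + \sum_j dotmx c (z j).
  rewrite -linear_sum -linearD -sumE linear_sum -cardI -sumr_const.
  by apply: eq_bigr => i _; have [] := Fx i.
by rewrite mulrS; lra.
Qed.

Lemma vertices_conv_sub S : vertices (conv S) `<=` S.
Proof.
move=> v /face_convE[c [b [_ vE]]].
have [w Sw] : S `&` [set x | dotmx c x = b] !=set0.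
  by apply: (@conv_neq0 _ v); rewrite -vE.
by have /subset_conv := Sw; rewrite -vE => <-; case: Sw.
Qed.

Lemma vertices_set0 : vertices (set0 : set 'M[R]_n) = set0.
Proof.
rewrite -subset0 => v [c [b [_ vE]]].
by have : [set v] v by []; rewrite vE => -[].
Qed.

End ConvexHulls.

Section PartialSums.
Variables (V : zmodType) (n : nat).
Implicit Types (f : 'I_n -> V) (j : 'I_n) (k : nat) (b : bool).

(* The sum of the entries lying before ([b = true]) or after ([b = false]) the
   [k]-th of the [n + 1] gaps of the word [f], numbered from [0]. *)
Definition partial_sum b f k : V := \sum_(l < n | (l < k)%N == b) f l.

Lemma partial_sum_head0 f : partial_sum true f 0 = 0.
Proof. exact: big_pred0. Qed.

Lemma partial_sum_head_full f : partial_sum true f n = \sum_l f l.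
Proof. by apply: eq_bigl => l; rewrite ltn_ord. Qed.

Lemma partial_sum_tail_full f : partial_sum false f n = 0.
Proof. by apply: big_pred0 => l; rewrite ltn_ord. Qed.

Lemma partial_sum_headS f j :
  partial_sum true f j.+1 = partial_sum true f j + f j.
Proof.
rewrite addrC [LHS](bigD1 j) ?ltnS ?leqnn //=; congr +%R; apply: eq_bigl => l.
by rewrite !eqb_id ltnS andbC -val_eqE /= -ltn_neqAle.
Qed.

Lemma partial_sum_compl f b k :
  partial_sum b f k + partial_sum (~~ b) f k = \sum_l f l.
Proof.
rewrite [RHS](bigID (fun l : 'I_n => (l < k)%N == b)) /=; congr +%R.
by apply: eq_bigl => l; case: b; case: ltnP.
Qed.

Lemma partial_sum_overlap f j :
  partial_sum true f j.+1 + partial_sum false f j = f j + \sum_l f l.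
Proof.
by rewrite partial_sum_headS -(partial_sum_compl f true j) [_ + f j]addrC addrA.
Qed.

Lemma partial_sum_telescope f (a : nat -> V) k :
  (forall j, f j = a j.+1 - a j) -> (k <= n)%N ->
  partial_sum true f k = a k - a 0%N.
Proof.
move=> fa; elim: k => [|k IHk] ltkn; first by rewrite partial_sum_head0 subrr.
by rewrite (partial_sum_headS f (Ordinal ltkn)) IHk 1?ltnW // fa addrC subrKA.
Qed.

End PartialSums.

Section AlternatingWords.
Variables (R : archiRealDomainType) (n : nat).
Implicit Types (f : 'I_n -> R) (s k : nat) (b : bool).

Definition alternating f : Prop :=
  [/\ forall l, [\/ f l = 0, f l = 1 | f l = -1],
      \sum_l f l = 1
    & forall j k : 'I_n, (j < k)%N -> f j != 0 -> f k != 0 ->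
        (forall l : 'I_n, (j < l < k)%N -> f l = 0) -> f k = - f j].

(* The lines of a higher spin alternating sign matrix (Behrend and Knight). *)
Definition spin_word s f : Prop :=
  \sum_l f l = s%:R /\
  forall b k, (k <= n)%N -> partial_sum b f k \is a Num.nat.

Lemma spin_word_head s f k : spin_word s f -> (k <= n)%N ->
  exists2 x, partial_sum true f k = x%:R & (x <= s)%N.
Proof.
move=> [fs fnat] kn; have /natrP[x xE] := fnat true k kn.
exists x => //; rewrite -(ler_nat R) -xE -fs -(partial_sum_compl f true k).
by rewrite lerDl natr_ge0 ?fnat.
Qed.

Lemma spin_word_diff s f (a : nat -> nat) :
  (forall j, f j = (a j.+1)%:R - (a j)%:R) -> a 0%N = 0%N -> a n = s ->
  (forall k, (k <= n)%N -> (a k <= s)%N) -> spin_word s f.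
Proof.
move=> fa a0 an a_le.
have headE k : (k <= n)%N -> partial_sum true f k = (a k)%:R.
  move=> kn; rewrite (partial_sum_telescope (a := fun k => (a k)%:R)) //.
  by rewrite a0 subr0.
have fs : \sum_l f l = s%:R by rewrite -partial_sum_head_full headE // an.
split=> // b k kn; case: b; first by rewrite headE ?natr_nat.
have -> : partial_sum false f k = s%:R - (a k)%:R.
  by rewrite -fs -(partial_sum_compl f true k) headE // addrC addKr.
by rewrite -natrB ?natr_nat ?a_le.
Qed.

Lemma spin_word1_partial_sum f b k : spin_word 1 f -> (k <= n)%N ->
  partial_sum b f k = (partial_sum b f k == 1)%:R.
Proof.
move=> fs kn; suff [x -> x1] : exists2 x, partial_sum b f k = x%:R & (x <= 1)%N.
  by rewrite pnatr_eq1; case: x x1 => [|[|]].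
have [x headE x1] := spin_word_head fs kn; case: b; first by exists x.
exists (1 - x)%N; last exact: leq_subr.
have [f1 _] := fs.
by rewrite natrB // -headE -f1 -(partial_sum_compl f true k) addrC addKr.
Qed.

Lemma alternating_block_sum f j k : alternating f -> (j <= k <= n)%N ->
  partial_sum true f k - partial_sum true f j = 0 \/
  exists p : 'I_n, [/\ (p < k)%N, f p != 0,
    forall l : 'I_n, (p < l < k)%N -> f l = 0 &
    partial_sum true f k - partial_sum true f j = f p].
Proof.
move=> [_ _ falt] /andP[]; elim: k => [|k IHk].
  by rewrite leqn0 => /eqP -> _; left; rewrite subrr.
rewrite leq_eqVlt => /orP[/eqP -> _|]; first by left; rewrite subrr.
rewrite ltnS => jk ltkn; pose o := Ordinal ltkn.
rewrite (partial_sum_headS f o) addrAC.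
have [fo|fo] := eqVneq (f o) 0.
  rewrite fo addr0.
  case: (IHk jk (ltnW ltkn)) => [->|[p [pk fp fz ->]]]; first by left.
  right; exists p; split=> // [|l]; first exact: ltnW.
  rewrite ltnS [(l <= k)%N]leq_eqVlt => /andP[pl /orP[/eqP lk|lk]].
    by rewrite (val_inj (lk : val l = val o)).
  by rewrite fz ?pl.
case: (IHk jk (ltnW ltkn)) => [->|[p [pk fp fz ->]]].
  right; exists o; rewrite add0r; split=> // l.
  by rewrite ltnS => /andP[/leq_trans/[apply]]; rewrite ltnn.
by left; rewrite (falt p o) // subrr.
Qed.

Lemma alternating_block_sum_sign f j k : alternating f -> (j <= k <= n)%N ->
  let d := partial_sum true f k - partial_sum true f j in
  [\/ d = 0, d = 1 | d = -1].
Proof.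
move=> fa jkn; case: (alternating_block_sum fa jkn) => [->|[p [_ _ _ ->]]].
  by constructor 1.
by case: fa => fsign _ _; exact: fsign.
Qed.

(* Both the first [k] entries and the other ones sum to [0], [1] or [-1], and
   the two sums add up to [1]. *)
Lemma alternating_spin_word1 f : alternating f -> spin_word 1 f.
Proof.
move=> fa; have [_ f1 _] := fa; split=> // b k kn.
have tailE : partial_sum false f k = 1 - partial_sum true f k.
  by rewrite -f1 -(partial_sum_compl f true k) addrC addKr.
have := alternating_block_sum_sign fa (introT andP (conj kn (leqnn n))).
have := alternating_block_sum_sign fa (introT andP (conj (leq0n k) kn)).
rewrite /= partial_sum_head0 subr0 partial_sum_head_full f1 -tailE.
by case: b; rewrite ?tailE => -[->|->|->];
  rewrite ?subr0 ?subrr ?opprK // => -[]; lra.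
Qed.

Lemma spin_word1_alternating f : spin_word 1 f -> alternating f.
Proof.
move=> fs; pose bit k : bool := partial_sum true f k == 1.
have fE (j : 'I_n) : f j = (bit j.+1)%:R - (bit j)%:R.
  have [ltjn lejn] := (ltn_ord j, ltnW (ltn_ord j)).
  rewrite -!(spin_word1_partial_sum true fs) //.
  by rewrite partial_sum_headS addrAC subrr add0r.
split=> [l||j k jk fj fk fz].
- by rewrite fE; do 2![case: (bit _)]; rewrite ?subrr ?subr0 ?sub0r;
    [constructor 1 | constructor 2 | constructor 3 | constructor 1].
- by have [-> _] := fs.
have bit_const m : (j < m <= k)%N -> bit m = bit j.+1.
  elim: m => [//|m IHm] /andP[]; rewrite ltnS leq_eqVlt.
  case/orP=> [/eqP -> //|jm mk]; rewrite -IHm ?jm 1?ltnW //.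
  have mn : (m < n)%N := ltn_trans mk (ltn_ord k).
  by rewrite /bit (partial_sum_headS f (Ordinal mn)) fz ?addr0 //= jm.
move: fj fk; rewrite !fE (bit_const k) ?jk ?leqnn //.
by do 3![case: (bit _)]; rewrite ?subrr ?eqxx ?subr0 ?sub0r ?opprK.
Qed.

End AlternatingWords.

Section Lines.
Variables (V : Type) (n : nat).
Implicit Types (A : 'M[V]_n).

Definition line A (b : bool) (i l : 'I_n) : V := if b then A i l else A l i.

Lemma line_tr A b i : line A^T b i = line A (~~ b) i.
Proof. by apply/funext => l; rewrite /line; case: b; rewrite mxE. Qed.

End Lines.

Lemma sum_divn_shift s x : (0 < s)%N -> (\sum_(m < s) (x + m) %/ s = x)%N.
Proof.
case: s => // s _; elim: x => [|x IHx].
  by apply: big1 => m _; rewrite add0n divn_small.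
under eq_bigr do rewrite addSnnS.
rewrite -[in RHS]IHx big_ord_recr [in RHS]big_ord_recl /= addn0 addnC.
by rewrite divnDr ?dvdnn // divnn addn1.
Qed.

Section HigherSpin.
Variables (R : archiRealDomainType) (n : nat).
Implicit Types (A : 'M[R]_n) (h : nat -> nat -> nat) (s : nat).

Definition higher_spin_ASM s A : Prop := forall b i, spin_word s (line A b i).

Definition corner_sum A (p q : nat) : R :=
  partial_sum true (fun i => partial_sum true (line A true i) q) p.

Definition mixed_diff (h : nat -> nat -> R) : 'M[R]_n :=
  \matrix_(i, j) (h i.+1 j.+1 - h i j.+1 - (h i.+1 j - h i j)).

(* [h p q] plays the part of the sum of the entries in the first [p] rows and
   [q] columns of a higher spin alternating sign matrix. *)
Definition row_steps s h : Prop := forall p, (p < n)%N ->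
  [/\ h p.+1 0%N = h p 0%N, h p.+1 n = (h p n + s)%N
    & forall q, (q <= n)%N -> (h p q <= h p.+1 q <= h p q + s)%N].

Lemma corner_sum_tr A p q : corner_sum A^T p q = corner_sum A q p.
Proof.
rewrite /corner_sum /partial_sum exchange_big.
by apply: eq_bigr => i _; apply: eq_bigr => j _; rewrite /line mxE.
Qed.

Lemma corner_sumK A : mixed_diff (corner_sum A) = A.
Proof.
apply/matrixP => i j; rewrite mxE /corner_sum !partial_sum_headS.
by rewrite [line A true i j]/line; lra.
Qed.

Lemma mixed_diff_tr (h : nat -> nat -> R) :
  (mixed_diff h)^T = mixed_diff (fun p q => h q p).
Proof. by apply/matrixP => i j; rewrite !mxE; lra. Qed.

Lemma row_steps_spin_word s h i : row_steps s h ->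
  spin_word s (line (mixed_diff (fun p q => (h p q)%:R)) true i).
Proof.
move=> hs; have [h0 hn hle] := hs i (ltn_ord i).
apply: (@spin_word_diff _ _ _ _ (fun q => h i.+1 q - h i q)%N) => [j|||q qn].
- have [/andP[le1 _] /andP[le2 _]] :=
    (hle _ (ltn_ord j), hle _ (ltnW (ltn_ord j))).
  by rewrite /line mxE !natrB.
- by rewrite h0 subnn.
- by rewrite hn addKn.
by have /andP[_] := hle q qn; rewrite leq_subLR.
Qed.

Lemma row_steps_higher_spin s h :
  row_steps s h -> row_steps s (fun p q => h q p) ->
  higher_spin_ASM s (mixed_diff (fun p q => (h p q)%:R)).
Proof.
move=> h_rows h_cols [] i; first exact: row_steps_spin_word.
rewrite -[mixed_diff _]trmxK mixed_diff_tr line_tr.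
exact: row_steps_spin_word.
Qed.

Lemma higher_spin_tr s A : higher_spin_ASM s A -> higher_spin_ASM s A^T.
Proof. by move=> As b i; rewrite line_tr; apply: As. Qed.

Definition corner_height A (p q : nat) : nat := Num.truncn (corner_sum A p q).

Lemma corner_heightE s A p q : higher_spin_ASM s A -> (q <= n)%N ->
  (corner_height A p q)%:R = corner_sum A p q.
Proof.
move=> As qn; apply: truncnK; apply: rpred_sum => i _.
by have [_] := As true i; apply.
Qed.

Lemma corner_height_tr A p q : corner_height A^T p q = corner_height A q p.
Proof. by rewrite /corner_height corner_sum_tr. Qed.

Lemma row_steps_corner_height s A :
  higher_spin_ASM s A -> row_steps s (corner_height A).
Proof.
move=> As p pn; have pA := As true (Ordinal pn).
have headE q x : (q <= n)%N ->
    partial_sum true (line A true (Ordinal pn)) q = x%:R ->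
    corner_height A p.+1 q = (corner_height A p q + x)%N.
  move=> qn xE; apply/eqP; rewrite -(eqr_nat R) natrD !(corner_heightE _ As) //.
  by rewrite -xE /corner_sum (partial_sum_headS _ (Ordinal pn)).
split=> [||q qn].
- by rewrite (headE 0%N 0%N) ?addn0 // partial_sum_head0.
- by apply: headE => //; rewrite partial_sum_head_full; case: pA.
have [x xE xs] := spin_word_head pA qn.
by rewrite (headE q x) // leq_addr leq_add2l.
Qed.

Lemma row_steps_divn s m h : (0 < s)%N -> row_steps s h ->
  row_steps 1 (fun p q => (h p q + m) %/ s)%N.
Proof.
move=> s_gt0 hs p pn; have [h0 hn hle] := hs p pn.
have divS x : ((x + s + m) %/ s = (x + m) %/ s + 1)%N.
  by rewrite addnAC divnDr ?dvdnn // divnn s_gt0.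
split=> [||q qn]; [by rewrite h0|by rewrite hn divS|].
have /andP[le1 le2] := hle q qn.
by rewrite leq_div2r ?leq_add2r //= -divS leq_div2r ?leq_add2r.
Qed.

Lemma higher_spin_decomposition s A : (0 < s)%N -> higher_spin_ASM s A ->
  exists C : 'I_s -> 'M[R]_n,
    (forall m, higher_spin_ASM 1 (C m)) /\ A = \sum_m C m.
Proof.
move=> s_gt0 As; pose h := corner_height A.
have h_rows : row_steps s h := row_steps_corner_height As.
have h_cols : row_steps s (fun p q => h q p).
  have := row_steps_corner_height (higher_spin_tr As).
  by congr row_steps; do 2!apply/funext => ?; rewrite corner_height_tr.
exists (fun m => mixed_diff (fun p q => ((h p q + m) %/ s)%:R)); split=> [m|].
  by apply: row_steps_higher_spin; exact: row_steps_divn.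
apply/matrixP => i j; rewrite summxE; under eq_bigr do rewrite mxE.
rewrite !sumrB -!natr_sum !sum_divn_shift //.
rewrite !(corner_heightE _ As) // 1?ltnW //.
by rewrite -{1}[A]corner_sumK mxE.
Qed.

End HigherSpin.

(* A dart [(b, i, k, o)] lies on row ([b = true]) or column ([b = false])
   number [i], joins the vertices number [k] and [k.+1] of this line, and
   points towards the latter iff [o]. *)
Definition dart (n : nat) : Type := (bool * 'I_n * 'I_n.+1 * bool)%type.

Section PathSums.
Variables (R : archiRealDomainType) (n : nat).
Implicit Types (A B : 'M[R]_n) (d : dart n).

Definition path_sum d A : R :=
  let: (b, i, k, o) := d in partial_sum o (line A b i) k.
Arguments path_sum : simpl never.

Lemma path_sum_is_scalar d : scalar (path_sum d).
Proof.
case: d => -[[b i] k] o c A B; rewrite /path_sum /partial_sum mulr_sumr.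
by rewrite -big_split; apply: eq_bigr => l _; case: b; rewrite /line !mxE.
Qed.

HB.instance Definition _ d :=
  GRing.isLinear.Build R 'M[R]_n R *%R (path_sum d) (path_sum_is_scalar d).

Lemma line_sum_path_sum A b i :
  \sum_l line A b i l = path_sum (b, i, ord_max, true) A.
Proof. by rewrite /path_sum partial_sum_head_full. Qed.

Lemma higher_spin_ASMP s A : higher_spin_ASM s A <->
  (forall b i, \sum_l line A b i l = s%:R) /\
  (forall d, path_sum d A \is a Num.nat).
Proof.
split=> [As|[As Anat] b i].
  split=> [b i|[[[b i] k] o]]; first by case: (As b i).
  by case: (As b i) => _; apply; rewrite -ltnS.
split=> // o k; rewrite -ltnS => kn.
exact: (Anat (b, i, Ordinal kn, o)).
Qed.

Lemma path_sum_spin1 d A : higher_spin_ASM 1 A ->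
  path_sum d A = (path_sum d A == 1)%:R.
Proof.
by case: d => -[[b i] k] o As; apply: spin_word1_partial_sum; rewrite // -ltnS.
Qed.

Lemma higher_spin_sumB (K : finType) (A : K -> 'M[R]_n) B :
  (forall k, higher_spin_ASM 1 (A k)) -> higher_spin_ASM 1 B ->
  (forall d, path_sum d B = 1 -> exists k, path_sum d (A k) = 1) ->
  (0 < #|K|)%N -> higher_spin_ASM #|K|.-1 (\sum_k A k - B).
Proof.
move=> As Bs BA K_gt0; apply/higher_spin_ASMP; split=> [b i|d].
  rewrite line_sum_path_sum linearB linear_sum /= -line_sum_path_sum (Bs b i).1.
  under eq_bigr do rewrite -line_sum_path_sum (As _ b i).1.
  by rewrite sumr_const -subn1 natrB.
have Anat k : path_sum d (A k) \is a Num.nat.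
  by have /higher_spin_ASMP[_] := As k; apply.
rewrite linearB linear_sum /= (path_sum_spin1 d Bs).
have [/BA[k Ak]|_] := eqVneq (path_sum d B) 1; last first.
  by rewrite subr0 rpred_sum.
by rewrite (bigD1 k) //= Ak [1 + _]addrC addrK rpred_sum.
Qed.

End PathSums.

Section ASM.
Variables (R : realType) (n : nat).
Implicit Types (A : 'M[R]_n).

Lemma is_ASM_alternating A : is_ASM A <-> forall b i, alternating (line A b i).
Proof.
split=> [[entry rsum csum ralt calt] [] i|alt].
- by split; [exact: entry | exact: rsum | exact: ralt].
- by split=> [l||]; [exact: entry | exact: csum | exact: calt].
have [row col] := (alt true, alt false).
split=> i; [by case: (row i) | by case: (row i) | by case: (col i)
           | by case: (row i) | by case: (col i)].
Qed.

Lemma is_ASM_spin1 A : is_ASM A <-> higher_spin_ASM 1 A.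
Proof.
rewrite is_ASM_alternating; split=> As b i.
  exact: alternating_spin_word1.
exact: spin_word1_alternating.
Qed.

End ASM.

Section Darts.
Variable n : nat.
Implicit Types (i j : 'I_n) (d : dart n) (G : grid).
Implicit Types (out : bool -> bool -> bool).

Definition line_vertex (b : bool) (i k : nat) : vertex :=
  if b then (i.+1, k) else (k, i.+1).

Definition dart_edge d : edge :=
  let: (b, i, k, o) := d in
  let v := line_vertex b i k in let w := line_vertex b i k.+1 in
  if o then (v, w) else (w, v).

Lemma dart_edge_inj : injective dart_edge.
Proof.
move=> [[[b i] k] o] [[[b' i'] k'] o']; rewrite /dart_edge /line_vertex.
case: b; case: b'; case: o; case: o' => -[*]; try by exfalso; lia.
all: by congr (_, _, _, _); apply/val_inj.
Qed.

Definition side_gap (l : 'I_n) (o : bool) : 'I_n.+1 :=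
  if o then lift ord0 l else widen_ord (leqnSn n) l.

(* The dart on the segment that joins the vertex of the entry [(i, j)] to the
   next ([o = true]) or previous vertex of its row ([b = true]) or column; it
   leaves the vertex iff [c]. *)
Definition node_dart i j (b o c : bool) : dart n :=
  let l := if b then j else i in
  (b, if b then i else j, side_gap l o, o == c).

Lemma node_dart_inj i j b o c b' o' c' :
  node_dart i j b o c = node_dart i j b' o' c' -> [/\ b = b', o = o' & c = c'].
Proof.
case=> <- _ /(congr1 val) seg; suff <- : o = o' by case: o c c' {seg} => -[] [].
by move: seg; case: o; case: o' => //=; rewrite /bump => seg; exfalso; lia.
Qed.

Lemma complete_flow_gridP e : complete_flow_grid n e <->
  exists i j b o, e = dart_edge (node_dart i j b o true).
Proof.
split=> [|[i [j [b [o ->]]]]]; last first.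
  split; first by case: b; case: o; rewrite /internal /= !ltn_ord.
  by case: b; case: o;
    [constructor 2 | constructor 1 | constructor 4 | constructor 3].
case: e => -[[|p] [|q]] w [] /=; rewrite /internal /= ?andbF // => /andP[pn qn].
case=> ->; exists (Ordinal pn), (Ordinal qn);
  by [exists true, false | exists true, true
     | exists false, false | exists false, true].
Qed.

(* [out b o] tells whether the edge on the side [(b, o)] of the vertex leaves
   it. *)
Definition node_star i j out : set edge :=
  [set e | exists b o, e = dart_edge (node_dart i j b o (out b o))].

Definition balanced out : Prop :=
  (out true false + out true true = out false false + out false true)%N.

Lemma node_starE i j out :
  let e b o := dart_edge (node_dart i j b o (out b o)) in
  node_star i j out =
    [set e true false; e true true] `|` [set e false false; e false true].
Proof.
apply/seteqP; split=> [_ [[] [[] ->]]|_ [[]|[]] ->].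
- by left; right.
- by left; left.
- by right; right.
- by right; left.
- by exists true, false.
- by exists true, true.
- by exists false, false.
- by exists false, true.
Qed.

Lemma in_node_star i j out b o c :
  node_star i j out (dart_edge (node_dart i j b o c)) <-> c = out b o.
Proof.
split=> [[b' [o' /dart_edge_inj/node_dart_inj[-> -> ->]]] //|->].
by exists b, o.
Qed.

(* Of the 16 orientations of the edges at a vertex, the six admissible ones are
   those with as many horizontal as vertical outgoing edges. *)
Lemma simple_nodeP i j (X : set edge) : let v : vertex := (i.+1, j.+1) in
  [\/ X = all_in v, X = all_out v
    | exists H V : set edge,
        [/\ H = rightward v \/ H = leftward v, V = downward v \/ V = upward v
          & X = H `|` V]] <->
  exists2 out, balanced out & X = node_star i j out.
Proof.
move=> v; split=> [[->|->|[H [V [HE VE ->]]]]|[out bal ->]].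
- by exists (fun _ _ => false); rewrite // node_starE setUA.
- by exists (fun _ _ => true); rewrite // node_starE setUA.
- case: HE => ->; case: VE => ->.
  + by exists (fun _ o => o); rewrite // node_starE.
  + by exists (fun b o => o == b); rewrite // node_starE [X in _ `|` X]setUC.
  + by exists (fun b o => o != b); rewrite // node_starE [X in X `|` _]setUC.
  + exists (fun _ o => ~~ o); rewrite // node_starE.
    by rewrite [X in X `|` _]setUC [X in _ `|` X]setUC.
rewrite node_starE; move: bal; rewrite /balanced.
case: (out true false); case: (out true true); case: (out false false);
  case: (out false true) => // _.
- by constructor 2; rewrite setUA.
- constructor 3; exists (leftward v), (upward v).
  by split; [right | right | congr setU; exact: setUC].
- constructor 3; exists (leftward v), (downward v).
  by split; [right | left | congr setU; exact: setUC].
- constructor 3; exists (rightward v), (upward v).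
  by split; [left | right | congr setU; exact: setUC].
- by constructor 3; exists (rightward v), (downward v); split; [left | left |].
- by constructor 1; rewrite setUA.
Qed.

Lemma dart_at_node i j d : let v : vertex := (i.+1, j.+1) in
  (dart_edge d).1 = v \/ (dart_edge d).2 = v <->
  exists b o c, d = node_dart i j b o c.
Proof.
move=> v; split=> [|[b [o [c ->]]]]; last first.
  by case: c; [left | right]; case: b; case: o.
case: d => -[[b l] k] o ends.
have {ends} : line_vertex b l k = v \/ line_vertex b l k.+1 = v.
  by case: o ends => -[]; auto.
case=> vE; exists b; [exists true, o | exists false, (~~ o)];
  move: vE; rewrite /v /node_dart; case: b => -[] *;
  congr (_, _, _, _); try by [apply/val_inj | case: o].
Qed.

Definition dart_in G d : bool := `[< G (dart_edge d) >].

Lemma incident_node_star G i j out : G `<=` complete_flow_grid n ->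
  incident G (i.+1, j.+1) = node_star i j out <->
  forall b o c, dart_in G (node_dart i j b o c) = (c == out b o).
Proof.
move=> GC; have in_incident b o c :
    incident G (i.+1, j.+1) (dart_edge (node_dart i j b o c)) <->
    G (dart_edge (node_dart i j b o c)).
  by split=> [[]|Ge] //; split=> //; apply/dart_at_node; exists b, o, c.
split=> [incE b o c|Gout].
  by apply/asboolP/eqP; rewrite -(in_node_star i j) -incE in_incident.
apply/seteqP; split=> [e [Ge]|_ [b [o ->]]]; last first.
  by apply/in_incident/asboolP; rewrite -/(dart_in _ _) Gout.
have /complete_flow_gridP[i' [j' [b' [o' eE]]]] := GC e Ge.
move: Ge; rewrite {}eE => /asboolP Ge /dart_at_node[b [o [c dE]]].
by move: Ge; rewrite dE in_node_star -/(dart_in _ _) Gout => /eqP.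
Qed.

Lemma dart_node_exists b i (k : 'I_n.+1) : exists i' j' o,
  forall c, node_dart i' j' b o c = (b, i, k, o == c).
Proof.
have [l [o kE]] : exists l o, k = side_gap l o.
  case: (unliftP ord0 k) => [l|] ->; first by exists l, true.
  have n_gt0 : (0 < n)%N by rewrite (leq_ltn_trans _ (ltn_ord i)).
  by exists (Ordinal n_gt0), false; apply/val_inj.
exists (if b then i else l), (if b then l else i), o => c.
by rewrite /node_dart kE; case: b.
Qed.

Lemma dart_out_or_border d :
  [\/ exists i j b o, d = node_dart i j b o true,
      exists b i, d = (b, i, ord0, true)
    | exists b i, d = (b, i, ord_max, false)].
Proof.
case: d => -[[b i] k] [].
  case: (unliftP ord0 k) => [l|] ->; last by constructor 2; exists b, i.
  constructor 1.
  exists (if b then i else l), (if b then l else i), b, true.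
  by rewrite /node_dart; case: b.
case: (unliftP ord_max k) => [l|] ->; last by constructor 3; exists b, i.
constructor 1.
exists (if b then i else l), (if b then l else i), b, false.
by case: b; congr (_, _, _, _); apply/ord_inj; rewrite lift_max.
Qed.

Lemma simple_flow_gridP G : simple_flow_grid n G <->
  [/\ G `<=` complete_flow_grid n,
      forall b i k, dart_in G (b, i, k, false) = ~~ dart_in G (b, i, k, true)
    & forall i j, balanced (fun b o => dart_in G (node_dart i j b o true))].
Proof.
split=> [[GC Gnode]|[GC Gseg Gbal]].
  have node i j : exists2 out, balanced out &
      forall b o c, dart_in G (node_dart i j b o c) = (c == out b o).
    have [|out bal starE] := (simple_nodeP i j _).1 (Gnode (i.+1, j.+1) _).
      by rewrite /internal /= !ltn_ord.
    by exists out => //; apply/incident_node_star.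
  split=> // [b i k|i j].
    have [i' [j' [o dE]]] := dart_node_exists b i k.
    have [out _ Gout] := node i' j'.
    have := Gout b o true; have := Gout b o false; rewrite !dE.
    by case: o {dE Gout} => -> ->; case: (out _ _).
  have [out bal Gout] := node i j.
  by rewrite /balanced !Gout !(eq_sym true) !eqb_id.
split=> // -[[|i] [|j]]; rewrite /internal //= ?andbF // => /andP[ltin ltjn].
pose i' := Ordinal ltin; pose j' := Ordinal ltjn.
apply/(simple_nodeP i' j').
exists (fun b o => dart_in G (node_dart i' j' b o true)); first exact: Gbal.
apply/(incident_node_star i' j') => // b o c.
by case: c; case: o; rewrite /= /node_dart ?Gseg ?negbK //; case: dart_in.
Qed.

Lemma simple_flow_grid_border G b i : simple_flow_grid n G ->
  ~~ dart_in G (b, i, ord0, true) /\ dart_in G (b, i, ord_max, true).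
Proof.
move=> /simple_flow_gridP[GC Gseg _]; split.
  by apply/asboolPn => /GC[]; case: b; rewrite /internal /= ?andbF.
rewrite -[dart_in _ _]negbK -Gseg; apply/asboolPn => /GC[].
by case: b; rewrite /internal /= ltnn ?andbF.
Qed.

End Darts.

Section FlowGridOfASM.
Variables (R : realType) (n : nat).
Implicit Types (A B : 'M[R]_n) (G : grid) (d : dart n).

Lemma path_sum_border A b i :
  path_sum (b, i, ord0, true) A = 0 /\ path_sum (b, i, ord_max, false) A = 0.
Proof. by rewrite /path_sum partial_sum_head0 partial_sum_tail_full. Qed.

Lemma gmx_nodeP A e : gmx A e <-> exists i j b o,
  e = dart_edge (node_dart i j b o true) /\
  path_sum (node_dart i j b o true) A = 1.
Proof.
have headE (f : 'I_n -> R) (j : 'I_n) :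
    partial_sum true f j.+1 = \sum_(k < n | (k <= j)%N) f k.
  by apply: eq_bigl => k; rewrite eqb_id.
have tailE (f : 'I_n -> R) (j : 'I_n) :
    partial_sum false f j = \sum_(k < n | (j <= k)%N) f k.
  by apply: eq_bigl => k; rewrite eqbF_neg -leqNgt.
split=> [|[i [j [b [o [-> sum1]]]]]].
  case: e => v w [i [j [/= ->]]] [] [-> sum1]; exists i, j;
    [exists true, true | exists true, false
    | exists false, true | exists false, false];
    by split=> //; rewrite -sum1 -?headE -?tailE.
exists i, j; move: sum1; case: b; case: o => /= sum1; split=> //;
  [constructor 1 | constructor 2 | constructor 3 | constructor 4];
  by split=> //; rewrite -sum1 -?headE -?tailE.
Qed.

Lemma gmx_complete A : gmx A `<=` complete_flow_grid n.
Proof.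
move=> e /gmx_nodeP[i [j [b [o [eE _]]]]].
by apply/complete_flow_gridP; exists i, j, b, o.
Qed.

Lemma gmx_dartP A d : gmx A (dart_edge d) <-> path_sum d A = 1.
Proof.
split=> [/gmx_nodeP[i [j [b [o [/dart_edge_inj <-]]]]] //|sum1].
apply/gmx_nodeP.
case: (dart_out_or_border d) => [[i [j [b [o dE]]]]|[b [i dE]]|[b [i dE]]].
- by exists i, j, b, o; rewrite -dE.
- by move/esym/eqP: sum1; rewrite dE (path_sum_border A b i).1 oner_eq0.
- by move/esym/eqP: sum1; rewrite dE (path_sum_border A b i).2 oner_eq0.
Qed.

Lemma dart_in_gmx A d : dart_in (gmx A) d = (path_sum d A == 1).
Proof. by apply/asboolP/eqP => /gmx_dartP. Qed.

Lemma path_sum_dart_in A d : is_ASM A -> path_sum d A = (dart_in (gmx A) d)%:R.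
Proof. by move=> /is_ASM_spin1 As; rewrite dart_in_gmx -path_sum_spin1. Qed.

Lemma path_sum_compl A b i k :
  path_sum (b, i, k, true) A + path_sum (b, i, k, false) A =
  \sum_l line A b i l.
Proof. exact: partial_sum_compl. Qed.

Lemma path_sum_overlap A i j b :
  path_sum (node_dart i j b false true) A +
  path_sum (node_dart i j b true true) A =
  A i j + \sum_l line A b (if b then i else j) l.
Proof. by rewrite addrC; case: b; rewrite /path_sum /= partial_sum_overlap. Qed.

Lemma path_sum_inj A B : (forall d, path_sum d A = path_sum d B) -> A = B.
Proof.
move=> AB; apply/matrixP => i j.
have : \sum_l line A true i l = \sum_l line B true i l.
  by rewrite !line_sum_path_sum AB.
have := path_sum_overlap A i j true; rewrite !AB path_sum_overlap => outE sumE.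
by move: outE; rewrite sumE => /addIr.
Qed.

Lemma gmx_simple A : is_ASM A -> simple_flow_grid n (gmx A).
Proof.
move=> aA; have /is_ASM_spin1 As := aA.
have sumE b i : \sum_l line A b i l = 1 by rewrite (As b i).1.
apply/simple_flow_gridP; split=> [|b i k|i j]; first exact: gmx_complete.
  have := path_sum_compl A b i k; rewrite sumE !path_sum_dart_in //.
  by case: dart_in; case: dart_in => //= sum1; exfalso; lra.
apply/eqP; rewrite -(eqr_nat R) !natrD -!path_sum_dart_in // !path_sum_overlap.
by rewrite !sumE.
Qed.

Definition ASM_of_grid G : 'M[R]_n := \matrix_(i, j)
  ((dart_in G (node_dart i j true false true))%:R +
   (dart_in G (node_dart i j true true true))%:R - 1).

Lemma line_ASM_of_grid G b i l : simple_flow_grid n G ->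
  line (ASM_of_grid G) b i l =
  (dart_in G (b, i, side_gap l true, true))%:R -
  (dart_in G (b, i, side_gap l false, true))%:R.
Proof.
move=> /simple_flow_gridP[_ Gseg Gbal].
have -> : line (ASM_of_grid G) b i l =
    (dart_in G (b, i, side_gap l false, false))%:R +
    (dart_in G (b, i, side_gap l true, true))%:R - 1.
  case: b; rewrite /line mxE //; congr (_ - _).
  by have /eqP := Gbal l i; rewrite -(eqr_nat R) !natrD => /eqP.
by rewrite Gseg; case: (dart_in G (b, i, side_gap l false, _)) => /=; lra.
Qed.

Lemma path_sum_ASM_of_grid G d : simple_flow_grid n G ->
  path_sum d (ASM_of_grid G) = (dart_in G d)%:R.
Proof.
move=> sG; have [_ Gseg _] := (simple_flow_gridP n G).1 sG.
have headE b i (k : 'I_n.+1) :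
    path_sum (b, i, k, true) (ASM_of_grid G) = (dart_in G (b, i, k, true))%:R.
  pose a l : R := (dart_in G (b, i, inord l, true))%:R.
  have diffE l : line (ASM_of_grid G) b i l = a l.+1 - a l.
    rewrite line_ASM_of_grid // /a.
    have -> : inord l.+1 = side_gap l true.
      by apply/val_inj; rewrite /= inordK // ltnS.
    have -> // : inord l = side_gap l false.
    by apply/val_inj; rewrite /= inordK // ltnW // ltnS.
  rewrite /path_sum (partial_sum_telescope diffE) -1?ltnS // /a inord_val.
  have -> : inord 0 = ord0 :> 'I_n.+1 by apply/val_inj; rewrite /= inordK.
  by have [/negbTE -> _] := simple_flow_grid_border b i sG; rewrite subr0.
case: d => -[[b i] k] [] //; rewrite Gseg.
have := path_sum_compl (ASM_of_grid G) b i k.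
have [_ last_in] := simple_flow_grid_border b i sG.
by rewrite line_sum_path_sum !headE last_in; case: dart_in => /=; lra.
Qed.

Lemma ASM_of_grid_is_ASM G : simple_flow_grid n G -> is_ASM (ASM_of_grid G).
Proof.
move=> sG; apply/is_ASM_spin1/higher_spin_ASMP.
split=> [b i|d]; last by rewrite path_sum_ASM_of_grid // natr_nat.
have [_ last_in] := simple_flow_grid_border b i sG.
by rewrite line_sum_path_sum path_sum_ASM_of_grid // last_in.
Qed.

Lemma ASM_of_gridK G : simple_flow_grid n G -> gmx (ASM_of_grid G) = G.
Proof.
move=> sG; have [GC _ _] := (simple_flow_gridP n G).1 sG.
have in_gmx d : gmx (ASM_of_grid G) (dart_edge d) <-> G (dart_edge d).
  rewrite gmx_dartP path_sum_ASM_of_grid //; split=> [/eqP|/asboolP].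
    by rewrite pnatr_eq1 eqb1 => /asboolP.
  by rewrite /dart_in => ->.
apply/seteqP; split=> e eG.
  have /complete_flow_gridP[i [j [b [o eE]]]] := gmx_complete eG.
  by rewrite eE in eG *; apply/in_gmx.
have /complete_flow_gridP[i [j [b [o eE]]]] := GC e eG.
by rewrite eE in eG *; apply/in_gmx.
Qed.

Lemma gmx_sub_eq A B : is_ASM A -> is_ASM B -> gmx A `<=` gmx B -> A = B.
Proof.
move=> aA aB AB; apply: path_sum_inj.
have subd d : dart_in (gmx A) d -> dart_in (gmx B) d.
  by move=> /asboolP/AB/asboolP.
have [_ Aseg _] := (simple_flow_gridP n _).1 (gmx_simple aA).
have [_ Bseg _] := (simple_flow_gridP n _).1 (gmx_simple aB).
have eq_head b (i : 'I_n) k :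
    dart_in (gmx A) (b, i, k, true) = dart_in (gmx B) (b, i, k, true).
  apply/idP/idP; first exact: (subd (b, i, k, true)).
  by apply: contraLR; rewrite -Aseg -Bseg; exact: (subd (b, i, k, false)).
by case=> -[[b i] k] []; rewrite !path_sum_dart_in // ?Aseg ?Bseg eq_head.
Qed.

End FlowGridOfASM.

Section FaceLattice.
Variables (R : realType) (n : nat).
Implicit Types (A B : 'M[R]_n) (G : grid) (F S : set 'M[R]_n).

Definition outside_flow G A : R :=
  \sum_(d : dart n | ~~ dart_in G d) path_sum d A.

Lemma outside_flow_is_scalar G : scalar (outside_flow G).
Proof.
move=> a A B; rewrite /outside_flow mulr_sumr -big_split.
by apply: eq_bigr => d _; rewrite linearP.
Qed.

HB.instance Definition _ G :=
  GRing.isLinear.Build R 'M[R]_n R *%R (outside_flow G)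
    (outside_flow_is_scalar G).

Lemma outside_flow_ge0 G A : is_ASM A -> 0 <= outside_flow G A.
Proof. by move=> aA; apply: sumr_ge0 => d _; rewrite path_sum_dart_in. Qed.

Lemma outside_flow_eq0 G A : is_ASM A -> outside_flow G A = 0 <-> gmx A `<=` G.
Proof.
move=> aA; split=> [flow0 e Ae|AG]; last first.
  apply: big1 => d nGd; rewrite path_sum_dart_in // /dart_in.
  by case: asboolP => // /AG/asboolP Gd; case/negP: nGd.
have /complete_flow_gridP[i [j [b [o eE]]]] := gmx_complete Ae.
rewrite {}eE in Ae *; apply: contrapT => /asboolPn nGd.
have ge0 d : ~~ dart_in G d -> 0 <= path_sum d A by rewrite path_sum_dart_in.
have /eqP := psumr_eq0P ge0 flow0 nGd.
by rewrite (gmx_dartP A _).1 // oner_eq0.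
Qed.

Lemma faces_face_of_grid G : faces (ASM_polytope R n) (face_of_grid R n G).
Proof.
have [c cE] := scalar_dotmx (\- outside_flow G).
have dotE A : dotmx c A = - outside_flow G A by rewrite -cE.
apply/face_convE; exists c, 0; split=> [A aA|].
  by rewrite dotE oppr_le0 outside_flow_ge0.
congr conv; apply/seteqP; split=> A [aA]; rewrite /= dotE => AG; split=> //=.
  by rewrite (outside_flow_eq0 G aA).2 ?oppr0.
by apply/(outside_flow_eq0 G aA)/eqP; rewrite -oppr_eq0 AG.
Qed.

Lemma face_of_grid_gmx A : is_ASM A -> face_of_grid R n (gmx A) = [set A].
Proof.
move=> aA; rewrite /face_of_grid (_ : [set B | _] = [set A]) ?conv_set1 //.
by apply/seteqP; split=> [B [aB BA]|_ ->] /=; [exact: gmx_sub_eq | split].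
Qed.

Lemma vertices_conv S : S `<=` @is_ASM R n -> vertices (conv S) = S.
Proof.
move=> Sasm; apply/seteqP; split=> [|A SA]; first exact: vertices_conv_sub.
have [c [b [cb AE]]] := faces_face_of_grid (gmx A).
rewrite (face_of_grid_gmx (Sasm A SA)) in AE.
have sub : conv S `<=` ASM_polytope R n by exact: conv_mono.
exists c, b; split=> [x /sub|]; first exact: cb.
apply/seteqP; split=> [_ ->|x [/sub Px xb]]; last by rewrite AE.
have : [set A] A by [].
by rewrite {1}AE => -[_ Ab]; split=> //; exact: subset_conv.
Qed.

Lemma gface_conv S :
  S `<=` @is_ASM R n -> gface (conv S) = \bigcup_(A in S) gmx A.
Proof. by move=> Sasm; rewrite /gface vertices_conv. Qed.

Lemma gface_mono F1 F2 : faces (ASM_polytope R n) F1 ->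
  faces (ASM_polytope R n) F2 -> F1 `<=` F2 -> gface F1 `<=` gface F2.
Proof.
move=> /face_convE[c1 [b1 [_ ->]]] /face_convE[c2 [b2 [cb ->]]] sub.
rewrite !gface_conv; [|by move=> A []..] => e [A A1 Ae]; exists A => //.
split; first by case: A1.
by have /subset_conv/sub := A1; rewrite -conv_face // => -[].
Qed.

Lemma face_of_grid_mono G1 G2 :
  G1 `<=` G2 -> face_of_grid R n G1 `<=` face_of_grid R n G2.
Proof.
by move=> G12; apply: conv_mono => A [aA AG1]; split=> // e /AG1/G12.
Qed.

Lemma gface_elementary F :
  faces (ASM_polytope R n) F -> elementary_flow_grid n (gface F).
Proof.
move=> /face_convE[c [b [_ ->]]]; rewrite gface_conv; last by move=> A [].
exists (@gmx R n @` (@is_ASM R n `&` [set x | dotmx c x = b])).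
split; last by rewrite bigcup_image.
by move=> _ [A [aA _] <-]; exact: gmx_simple.
Qed.

Lemma face_of_gridK G :
  elementary_flow_grid n G -> gface (face_of_grid R n G) = G.
Proof.
move=> [S [sS ->]]; rewrite gface_conv; last by move=> A [].
apply/seteqP; split=> [e [A [_ AG] /AG]|e [H SH He]] //.
have sH := sS H SH; exists (ASM_of_grid R n H); rewrite ?ASM_of_gridK //.
split; first exact: ASM_of_grid_is_ASM.
by rewrite ASM_of_gridK // => e' He'; exists H.
Qed.

Lemma ASM_exchange (K : finType) (A : K -> 'M[R]_n) B :
  (1 < #|K|)%N -> (forall k, is_ASM (A k)) -> is_ASM B ->
  (forall d, path_sum d B = 1 -> exists k, path_sum d (A k) = 1) ->
  exists C : 'I_#|K|.-1 -> 'M[R]_n,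
    (forall m, is_ASM (C m)) /\ \sum_k A k = B + \sum_m C m.
Proof.
move=> K_gt1 aA aB BA; have K_gt0 := ltnW K_gt1.
have spinK : higher_spin_ASM #|K|.-1 (\sum_k A k - B).
  by apply: higher_spin_sumB => // [k|]; exact/is_ASM_spin1.
have pred_gt0 : (0 < #|K|.-1)%N by rewrite -ltnS prednK.
have [C [Cs CE]] := higher_spin_decomposition pred_gt0 spinK.
by exists C; split=> [m|]; [exact/is_ASM_spin1 | rewrite -CE addrC subrK].
Qed.

Lemma vertices_face_ASM F A :
  faces (ASM_polytope R n) F -> vertices F A -> is_ASM A /\ F A.
Proof.
move=> /face_convE[c [b [_ ->]]] /vertices_conv_sub SA.
by split; [case: SA | exact: subset_conv].
Qed.

Hypothesis n_gt0 : (0 < n)%N.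

Lemma gmx_neq0 A : is_ASM A -> exists d : dart n, gmx A (dart_edge d).
Proof.
move=> aA; pose i := Ordinal n_gt0.
exists (true, i, ord_max, true); apply/gmx_dartP.
have [_ last_in] := simple_flow_grid_border true i (gmx_simple aA).
by rewrite path_sum_dart_in // last_in.
Qed.

Lemma mem_face_of_gmx_sub F B :
  faces (ASM_polytope R n) F -> is_ASM B -> gmx B `<=` gface F -> F B.
Proof.
move=> Fface aB BF; have [d0 /BF[A0 A0F _]] := gmx_neq0 aB.
have /choice[A AP] (d : dart n) :
    exists A, vertices F A /\ (path_sum d B = 1 -> path_sum d A = 1).
  have [/eqP Bd|nBd] := boolP (path_sum d B == 1).
    by have /gmx_dartP/BF[A AF /gmx_dartP Ad] := Bd; exists A.
  by exists A0; split=> // /eqP Bd; rewrite Bd in nBd.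
have AF d : is_ASM (A d) /\ F (A d).
  by apply: vertices_face_ASM => //; case: (AP d).
have card_dart : (1 < #|{: dart n}|)%N.
  rewrite !card_prod !card_bool !card_ord.
  by case: n n_gt0 => // m _; lia.
have [|d Bd|C [aC sumE]] := ASM_exchange card_dart (A := A) _ aB.
- by move=> d; case: (AF d).
- by exists d; case: (AP d) => _; apply.
apply: (face_summand Fface (x := A) _ _ _ _ sumE) => [d||m|].
- by case: (AF d).
- exact: subset_conv.
- exact: subset_conv.
by rewrite card_ord prednK // ltnW.
Qed.

Lemma gfaceK F : faces (ASM_polytope R n) F -> face_of_grid R n (gface F) = F.
Proof.
move=> Fface; have [c [b [cb FE]]] := (face_convE _ _).1 Fface.
rewrite [RHS]FE; congr conv; apply/seteqP; split=> A [aA].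
  move=> /(mem_face_of_gmx_sub Fface aA).
  by rewrite FE -conv_face // => -[].
move=> Ab; split=> // e Ae; exists A => //; rewrite FE vertices_conv // => B [].
Qed.

Lemma gface_le F1 F2 :
  faces (ASM_polytope R n) F1 -> faces (ASM_polytope R n) F2 ->
  F1 `<=` F2 <-> gface F1 `<=` gface F2.
Proof.
move=> F1face F2face; split; first exact: gface_mono.
by move=> /face_of_grid_mono; rewrite !gfaceK.
Qed.

End FaceLattice.

Lemma unions_inclusion_lattice (T : Type) (X : set (set T)) :
  is_inclusion_lattice
    [set G | exists S : set (set T), S `<=` X /\ G = \bigcup_(H in S) H].
Proof.
move=> _ _ [SA [sA ->]] [SB [sB ->]]; split.
  exists (\bigcup_(H in [set H | [/\ X H, H `<=` \bigcup_(K in SA) K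
                               & H `<=` \bigcup_(K in SB) K]]) H); split.
  - by eexists; split; last by []; move=> H [].
  - by move=> x [H [_ HA _] /HA].
  - by move=> x [H [_ _ HB] /HB].
  move=> _ [S [sS ->]] SSA SSB x [H SH Hx].
  have HS : H `<=` \bigcup_(K in S) K by exact: bigcup_sup.
  exists H => //; split; first exact: sS.
    exact: subset_trans SSA.
  exact: subset_trans SSB.
exists (\bigcup_(H in SA `|` SB) H); split.
- by exists (SA `|` SB); split=> // H [/sA|/sB].
- by apply: bigcup_subset => H; left.
- by apply: bigcup_subset => H; right.
by move=> C _ subAC subBC; rewrite bigcup_setU subUset.
Qed.

Lemma inclusion_lattice_iso (T U : Type) (X : set (set T)) (Y : set (set U))
    (f : set T -> set U) :
  set_fun X Y f -> set_surj X Y f ->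
  (forall A B, X A -> X B -> (A `<=` B <-> f A `<=` f B)) ->
  is_inclusion_lattice Y -> is_inclusion_lattice X.
Proof.
move=> fXY fsurj fle Ylat A B XA XB.
have [[_ [/fsurj[M XM <-] MA MB Mmax]] [_ [/fsurj[J XJ <-] AJ BJ Jmin]]] :=
  Ylat _ _ (fXY _ XA) (fXY _ XB).
split; [exists M | exists J]; split=> //; try exact/fle.
  move=> C XC CA CB; apply/fle => //.
  by apply: Mmax; [exact: fXY | exact/fle | exact/fle].
move=> C XC AC BC; apply/fle => //.
by apply: Jmin; [exact: fXY | exact/fle | exact/fle].
Qed.

Theorem theorem4p3 (R : realType) (n : nat) (n_gt0 : (0 < n)%N) :
  (is_inclusion_lattice (faces (ASM_polytope R n)) /\
   is_inclusion_lattice (elementary_flow_grid n)) /\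
  [/\ set_bij (faces (ASM_polytope R n)) (elementary_flow_grid n)
        (fun F => gface F),
      (forall F1 F2 : set 'M[R]_n,
         faces (ASM_polytope R n) F1 -> faces (ASM_polytope R n) F2 ->
         (F1 `<=` F2 <-> gface F1 `<=` gface F2)),
      (forall F : set 'M[R]_n, faces (ASM_polytope R n) F ->
         face_of_grid R n (gface F) = F),
      (forall G : grid, elementary_flow_grid n G ->
         faces (ASM_polytope R n) (face_of_grid R n G) /\
         gface (face_of_grid R n G) = G)
    & [/\ faces (ASM_polytope R n) set0,
          elementary_flow_grid n set0
        & gface (set0 : set 'M[R]_n) = set0]].
Proof.
set X := faces _; set Y := elementary_flow_grid n.
have gface_fun : set_fun X Y (@gface R n) by move=> F; exact: gface_elementary.
have gface_surj : set_surj X Y (@gface R n).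
  move=> G YG; exists (face_of_grid R n G); last exact: face_of_gridK.
  exact: faces_face_of_grid.
have gface_iso := @gface_le R n n_gt0.
have Y_lattice : is_inclusion_lattice Y by exact: unions_inclusion_lattice.
split; first split=> //.
  exact: inclusion_lattice_iso gface_fun gface_surj gface_iso Y_lattice.
split=> //.
- split=> //; apply: can_in_inj (face_of_grid R n) _ => F /set_mem.
  exact: gfaceK.
- by move=> F; exact: gfaceK.
- by move=> G YG; split; [exact: faces_face_of_grid | exact: face_of_gridK].
split; [exact: faces_set0 | by exists set0; rewrite bigcup_set0 |].
by rewrite /gface vertices_set0 bigcup_set0.
Qed.
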